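(* Let $H$ be a real Hilbert space and, for $A\in\mathcal K^H$, let $p(A)$ be the point of $A$ nearest to the origin. Then: (1) The map $\nu:(\mathcal K^H,d_{AW})\to\mathbb R$ given by $\nu(A)=\|p(A)\|$ is continuous. (2) The map $p:(\mathcal K^H,d_{AW})\to(H,\|\cdot\|)$ is continuous. (3) In particular, for $H=\mathbb R^n$, the map $p:(\mathcal K^n,\tau_F)\to(\mathbb R^n,\|\cdot\|)$ is continuous.
   Context: $\mathcal K^H$ is the family of all nonempty closed convex subsets of $H$, and $\mathcal K^n:=\mathcal K^{\mathbb R^n}$. The Attouch-Wets metric on $\mathcal K^H$ is $$d_{AW}(A,B)=\sup_{j\in\mathbb N}\min\Big\{\tfrac1j,\ \sup_{\|x\|<j}|d(x,A)-d(x,B)|\Big\},$$ where $d(x,A)=\inf_{a\in A}\|x-a\|$ and $\mathbb N=\{1,2,\dots\}$. The Fell topology $\tau_F$ on $\mathcal K^n$ is generated by the sets $U^-=\{A: A\cap U\ne\emptyset\}$ ($U\subset\mathbb R^n$ open) and $(\mathbb R^n\setminus C)^+=\{A: A\subset\mathbb R^n\setminus C\}$ ($C\subset\mathbb R^n$ compact). *)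

(* Defs.v *)
From HB Require Import structures.
From mathcomp Require Import all_boot all_order all_algebra.
From mathcomp Require Import all_classical all_reals all_analysis.
From mathcomp Require Import ring lra.

Set Implicit Arguments.
Unset Strict Implicit.
Unset Printing Implicit Defensive.

Import Order.TTheory GRing.Theory Num.Theory.
Import numFieldNormedType.Exports.

Local Open Scope classical_set_scope.
Local Open Scope ring_scope.

(* Positive definiteness of [inner] follows from [inner_norm]. *)
HB.mixin Record CompleteNormedModule_isHilbert (R : realType) H
    & CompleteNormedModule R H := {
  inner : H -> H -> R ;
  innerC : forall x y : H, inner x y = inner y x ;
  innerDl : forall x y z : H, inner (x + y) z = inner x z + inner y z ;
  innerZl : forall (a : R) (x y : H), inner (a *: x) y = a * inner x y ;
  inner_norm : forall x : H, inner x x = `|x| ^+ 2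
}.

#[short(type="hilbertType")]
HB.structure Definition Hilbert (R : realType) :=
  {H of CompleteNormedModule R H & CompleteNormedModule_isHilbert R H}.

(* ['rV[R]_n] carries the sup norm in the library, hence the alias. *)
Definition euclidean (R : realType) (n : nat) : Type := 'rV[R]_n.

HB.instance Definition _ (R : realType) (n : nat) :=
  GRing.Lmodule.copy (euclidean R n) 'rV[R]_n.

Section Euclidean.
Context {R : realType} {n : nat}.
Implicit Types x y z : euclidean R n.

Definition dotp x y : R := \sum_(i < n) x ord0 i * y ord0 i.

Definition enorm x : R := Num.sqrt (dotp x x).

Let dotpC x y : dotp x y = dotp y x.
Proof. by apply: eq_bigr => i _; rewrite mulrC. Qed.

Let dotpDl x y z : dotp (x + y) z = dotp x z + dotp y z.
Proof. by rewrite -big_split; apply: eq_bigr => i _; rewrite mxE mulrDl. Qed.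

Let dotpZl (a : R) x y : dotp (a *: x) y = a * dotp x y.
Proof. by rewrite mulr_sumr; apply: eq_bigr => i _; rewrite mxE mulrA. Qed.

Let dotp_ge0 x : 0 <= dotp x x.
Proof. by apply: sumr_ge0 => i _; rewrite -expr2 sqr_ge0. Qed.

Let coord_le_dotp x i : x ord0 i ^+ 2 <= dotp x x.
Proof.
rewrite /dotp (bigD1 i)//= -expr2 lerDl; apply: sumr_ge0 => j _.
by rewrite -expr2 sqr_ge0.
Qed.

Let dotp_eq0 x : dotp x x = 0 -> x = 0.
Proof.
move=> x0; apply/rowP => i; rewrite mxE; apply/eqP.
by rewrite -sqrf_eq0 eq_le sqr_ge0 andbT -x0 coord_le_dotp.
Qed.

Let dotp_CS x y : dotp x y ^+ 2 <= dotp x x * dotp y y.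
Proof.
have [y0|y0] := eqVneq (dotp y y) 0.
  rewrite (dotp_eq0 y0) /dotp big1 ?expr0n; last by move=> i _; rewrite mxE mulr0.
  by rewrite [X in _ * X]big1 ?mulr0// => i _; rewrite mxE mulr0.
have y_gt0 : 0 < dotp y y by rewrite lt_neqAle eq_sym y0 dotp_ge0.
have := dotp_ge0 (dotp y y *: x + (- dotp x y) *: y).
rewrite !(dotpDl, dotpZl) ![dotp _ (_ *: _ + _)]dotpC !(dotpDl, dotpZl).
rewrite (dotpC y x) => h.
have : 0 <= dotp y y * (dotp x x * dotp y y - dotp x y ^+ 2).
  by apply: (le_trans h); rewrite le_eqVlt; apply/orP; left; apply/eqP; ring.
by rewrite pmulr_rge0// subr_ge0.
Qed.

Let enorm_sqr x : enorm x ^+ 2 = dotp x x.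
Proof. by rewrite sqr_sqrtr. Qed.

Let enormD x y : enorm (x + y) <= enorm x + enorm y.
Proof.
rewrite -ler_sqr ?nnegrE ?addr_ge0 ?sqrtr_ge0// sqrrD !enorm_sqr.
rewrite dotpDl ![dotp _ (_ + _)]dotpC !dotpDl (dotpC y x).
suff : dotp x y <= enorm x * enorm y by lra.
rewrite (le_trans (ler_norm _))// -sqrtr_sqr /enorm -sqrtrM//.
by rewrite ler_sqrt ?mulr_ge0.
Qed.

Let enormZ (a : R) x : enorm (a *: x) = `|a| * enorm x.
Proof.
rewrite /enorm dotpZl dotpC dotpZl mulrA -expr2 sqrtrM ?sqr_ge0//.
by rewrite sqrtr_sqr.
Qed.

Let enorm0_eq0 x : enorm x = 0 -> x = 0.
Proof. by move=> x0; apply: dotp_eq0; rewrite -enorm_sqr x0 expr0n. Qed.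

HB.instance Definition _ :=
  Lmodule_isNormed.Build R (euclidean R n) enormD enormZ enorm0_eq0.

Let euclidean_complete (F : set_system (euclidean R n)) :
  ProperFilter F -> cauchy F -> cvg F.
Proof.
move=> FF /cauchy_ballP Fc.
have : cauchy (F : set_system 'rV[R]_n).
  apply/cauchy_ballP => e e0; apply: filterS (Fc e e0) => -[x y]/= xy.
  split=> // i j; rewrite ord1 -ball_normE/=.
  apply: le_lt_trans xy; rewrite -[X in _ <= X]/(enorm (x - y)) -sqrtr_sqr.
  rewrite ler_sqrt//; apply: le_trans (coord_le_dotp _ j).
  by rewrite !mxE.
move=> /cauchy_cvg /cvg_ex[/= l Fl]; apply/cvg_ex; exists (l : euclidean R n).
apply/cvgrPdist_lt => e e0.
have d0 : 0 < e / n.+1%:R by rewrite divr_gt0.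
move/cvg_ballP : Fl => /(_ _ d0); apply: filterS => x [_ lx].
rewrite -[X in X < _]/(enorm (l - x : euclidean R n)).
rewrite -(@ltr_pXn2r _ 2)// ?nnegrE ?sqrtr_ge0 ?ltW// enorm_sqr.
apply: (@le_lt_trans _ _ (\sum_(i < n) (e / n.+1%:R) ^+ 2)).
  apply: ler_sum => i _; rewrite -expr2 -real_normK ?num_real//.
  rewrite lerXn2r ?nnegrE ?normr_ge0 ?ltW// !mxE.
  by have := lx ord0 i; rewrite -ball_normE.
rewrite sumr_const card_ord -[X in X < _]mulr_natl expr_div_n mulrCA.
rewrite gtr_pMr ?exprn_gt0//.
rewrite ltr_pdivrMr ?exprn_gt0// mul1r -natrX ltr_nat.
by rewrite expnS mulSn expn1 addSn ltnS leq_addr.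
Qed.

HB.instance Definition _ :=
  Uniform_isComplete.Build (euclidean R n) euclidean_complete.

Let dotp_norm x : dotp x x = `|x| ^+ 2.
Proof. by rewrite -enorm_sqr. Qed.

HB.instance Definition _ :=
  CompleteNormedModule_isHilbert.Build R (euclidean R n)
    dotpC dotpDl dotpZl dotp_norm.

End Euclidean.

Record closed_convex (R : realType) (H : hilbertType R) := ClosedConvex {
  cc_set :> set H ;
  cc_nonempty : cc_set !=set0 ;
  cc_closed : closed cc_set ;
  cc_convex : convex_set cc_set
}.

HB.instance Definition _ (R : realType) (H : hilbertType R) :=
  gen_eqMixin (closed_convex H).
HB.instance Definition _ (R : realType) (H : hilbertType R) :=
  gen_choiceMixin (closed_convex H).

Lemma closed_convex_eq (R : realType) (H : hilbertType R)
  (A B : closed_convex H) : A = B :> set H -> A = B.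
Proof.
case: A B => [A A0 Ac Av] [B B0 Bc Bv] /= AB; subst B.
by congr ClosedConvex; exact: Prop_irrelevance.
Qed.

Section Distance.
Context {R : realType} {H : hilbertType R}.
Implicit Types (x y : H) (A B C : closed_convex H).

Definition dist_to x (A : set H) : R := inf [set `|x - a| | a in A].

Let has_inf_dist x A : has_inf [set `|x - a| | a in A].
Proof.
split; first by have [a Aa] := cc_nonempty A; exists `|x - a|, a.
by exists 0 => _ [a _ <-].
Qed.

Let dist_to_le x A a : cc_set A a -> dist_to x A <= `|x - a|.
Proof. by move=> Aa; apply: ge_inf; [case: (has_inf_dist x A)|exists a]. Qed.

Let dist_to_ge x A r : (forall a, cc_set A a -> r <= `|x - a|) -> r <= dist_to x A.
Proof.
move=> h; apply: lb_le_inf; first by case: (has_inf_dist x A).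
by move=> _ [a Aa <-]; exact: h.
Qed.

Let dist_toD x y A : dist_to x A <= `|x - y| + dist_to y A.
Proof.
rewrite -lerBlDl; apply: dist_to_ge => a Aa; rewrite lerBlDl.
by rewrite (le_trans (dist_to_le x Aa))// -(subrKA y) ler_normD.
Qed.

Let dist_to_eq0 x A : dist_to x A = 0 -> cc_set A x.
Proof.
move=> d0; apply: (cc_closed (c := A)) => V /nbhs_ballP[e /= e0 eV].
have [_ [a Aa <-]] := inf_adherent e0 (has_inf_dist x A).
rewrite -/(dist_to x A) d0 add0r => xa.
by exists a; split => //; apply: eV; rewrite -ball_normE.
Qed.

(* Both real suprema are over nonempty bounded sets: see [has_sup_aw_gap] and
   [has_sup_aw_dist]. *)
Definition aw_gap (j : nat) A B : R :=
  sup [set `|dist_to x A - dist_to x B| | x in [set x : H | `|x| < j%:R]].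

Definition aw_dist A B : R :=
  sup [set Num.min (j%:R^-1) (aw_gap j A B) | j in [set j : nat | (0 < j)%N]].

Lemma has_sup_aw_gap (j : nat) A B : (0 < j)%N ->
  has_sup [set `|dist_to x A - dist_to x B| | x in [set x : H | `|x| < j%:R]].
Proof.
move=> j0; split.
  by exists `|dist_to 0 A - dist_to 0 B|, 0 => //=; rewrite normr0 ltr0n.
exists (j%:R + j%:R + `|dist_to 0 A - dist_to 0 B|) => _ [x /= xj <-].
have := dist_toD x 0 A; have := dist_toD 0 x A.
have := dist_toD x 0 B; have := dist_toD 0 x B.
rewrite !subr0 sub0r normrN => h1 h2 h3 h4.
have := ler_norm (dist_to 0 A - dist_to 0 B).
have := ler_norm (- (dist_to 0 A - dist_to 0 B)); rewrite normrN => h5 h6.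
by rewrite ler_norml; apply/andP; split; lra.
Qed.

Lemma has_sup_aw_dist A B : has_sup
  [set Num.min (j%:R^-1) (aw_gap j A B) | j in [set j : nat | (0 < j)%N]].
Proof.
split; first by exists (Num.min 1%:R^-1 (aw_gap 1 A B)), 1%N.
exists 1 => _ [j /= j0 <-]; rewrite ge_min; apply/orP; left.
by rewrite invf_le1 ?ltr0n// ler1n.
Qed.

Let aw_gap_ge (j : nat) A B x : `|x| < j%:R ->
  `|dist_to x A - dist_to x B| <= aw_gap j A B.
Proof.
move=> xj; apply: ub_le_sup; last by exists x.
have j0 : (0 < j)%N by rewrite -(ltr0n R) (le_lt_trans _ xj).
by case: (has_sup_aw_gap A B j0).
Qed.

Let aw_gap_ge0 (j : nat) A B : (0 < j)%N -> 0 <= aw_gap j A B.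
Proof.
move=> j0; apply: le_trans (@aw_gap_ge _ A B 0 _); first exact: normr_ge0.
by rewrite normr0 ltr0n.
Qed.

Let aw_gap_triangle (j : nat) B A C : (0 < j)%N ->
  aw_gap j A C <= aw_gap j A B + aw_gap j B C.
Proof.
move=> j0; apply: ge_sup; first by case: (has_sup_aw_gap A C j0).
move=> _ [x xj <-].
by rewrite -(subrKA (dist_to x B)) (le_trans (ler_normD _ _))// lerD ?aw_gap_ge.
Qed.

Let aw_dist_ge (j : nat) A B : (0 < j)%N ->
  Num.min (j%:R^-1) (aw_gap j A B) <= aw_dist A B.
Proof.
by move=> j0; apply: ub_le_sup; [case: (has_sup_aw_dist A B)|exists j].
Qed.

Lemma aw_distxx A : aw_dist A A = 0.
Proof.
apply/eqP; rewrite eq_le; apply/andP; split.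
  apply: ge_sup; first by case: (has_sup_aw_dist A A).
  move=> _ [j /= j0 <-]; rewrite ge_min; apply/orP; right.
  apply: ge_sup; first by case: (has_sup_aw_gap A A j0).
  by move=> _ [x _ <-]; rewrite subrr normr0.
apply: le_trans (@aw_dist_ge 1 A A isT).
by rewrite le_min invr_ge0 ler0n aw_gap_ge0.
Qed.

Lemma aw_dist_sym A B : aw_dist A B = aw_dist B A.
Proof.
congr sup; apply: eq_imagel => j _; congr Num.min.
by congr sup; apply: eq_imagel => x _; rewrite distrC.
Qed.

Lemma aw_dist_triangle B A C : aw_dist A C <= aw_dist A B + aw_dist B C.
Proof.
apply: ge_sup; first by case: (has_sup_aw_dist A C).
move=> _ [j /= j0 <-].
apply: le_trans (lerD (aw_dist_ge A B j0) (aw_dist_ge B C j0)).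
have := aw_gap_triangle B A C j0.
have := aw_gap_ge0 A B j0; have := aw_gap_ge0 B C j0.
have : 0 <= j%:R^-1 :> R by rewrite invr_ge0.
rewrite !minEle; case: ifPn; case: ifPn; case: ifPn; lra.
Qed.

Lemma aw_dist_eq0 A B : aw_dist A B = 0 -> A = B.
Proof.
move=> AB0.
have dAB x : dist_to x A = dist_to x B.
  pose j := (Num.truncn `|x|).+1.
  have j0 : (0 < j)%N by [].
  have /aw_gap_ge xj : `|x| < j%:R by exact: truncnS_gt.
  have := aw_dist_ge A B j0; rewrite AB0 ge_min leNgt invr_gt0 ltr0n j0/=.
  move=> /(le_trans (xj A B)); rewrite normr_le0 subr_eq0 => /eqP.
  exact.
have sub (C D : closed_convex H) : (forall x, dist_to x C = dist_to x D) ->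
    (C : set H) `<=` D.
  move=> CD x Cx; apply: dist_to_eq0; apply/eqP; rewrite -CD eq_le.
  rewrite dist_to_ge ?andbT; last by move=> *; exact: normr_ge0.
  by rewrite (le_trans (dist_to_le x Cx))// subrr normr0.
by apply: closed_convex_eq; apply/seteqP; split; exact: sub.
Qed.

End Distance.

(* [attouch_wets H] and [fell H] are copies of [closed_convex H], carrying the
   topology of [aw_dist] and the Fell topology respectively. *)
Definition attouch_wets (R : realType) (H : hilbertType R) : Type :=
  closed_convex H.

HB.instance Definition _ (R : realType) (H : hilbertType R) :=
  Choice.copy (attouch_wets H) (closed_convex H).

HB.instance Definition _ (R : realType) (H : hilbertType R) :=
  isMetric.Build R (attouch_wets H)
    (@aw_distxx R H) (@aw_dist_eq0 R H) (@aw_dist_sym R H)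
    (@aw_dist_triangle R H).

Section Fell.
Context {R : realType} {H : hilbertType R}.

Definition hit (U : set H) : set (closed_convex H) :=
  [set A : closed_convex H | A `&` U !=set0].

Definition miss (C : set H) : set (closed_convex H) :=
  [set A : closed_convex H | A `<=` ~` C].

Definition fell_subbase : set (set (closed_convex H)) :=
  [set hit U | U in [set U : set H | open U]] `|`
  [set miss C | C in [set C : set H | compact C]].

End Fell.

Definition fell (R : realType) (H : hilbertType R) : Type := closed_convex H.

HB.instance Definition _ (R : realType) (H : hilbertType R) :=
  Choice.copy (fell H) (closed_convex H).

HB.instance Definition _ (R : realType) (H : hilbertType R) :=
  @isSubBaseTopological.Build (fell H)
    (set (fell H)) (@fell_subbase R H) id.

Section Nearest.
Context {R : realType} {H : hilbertType R}.

Definition is_nearest (A : set H) : set H :=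
  [set a | A a /\ forall b, A b -> `|a| <= `|b|].

(* The default value [0] is never used: see [nearestP]. *)
Definition nearest (A : closed_convex H) : H := xget 0 (is_nearest A).

Let parallelogram (x y : H) :
  `|x - y| ^+ 2 + `|x + y| ^+ 2 = 2 * (`|x| ^+ 2 + `|y| ^+ 2).
Proof.
have innerNl (u v : H) : inner (- u) v = - inner u v.
  by rewrite -scaleN1r innerZl mulN1r.
rewrite -!inner_norm !innerDl ![inner _ (_ + _)]innerC.
rewrite !innerDl !innerNl ![inner _ (- _)]innerC !innerNl (innerC y x).
ring.
Qed.

Let midpoint (A : closed_convex H) (x y : H) (r : R) :
  cc_set A x -> cc_set A y -> (forall a, cc_set A a -> r <= `|a| ^+ 2) ->
  `|x - y| ^+ 2 <= 2 * (`|x| ^+ 2 + `|y| ^+ 2) - 4 * r.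
Proof.
move=> Ax Ay rA; rewrite -parallelogram.
have h01 : 0 <= (2^-1 : R) <= 1 by apply/andP; split; lra.
have : cc_set A (2^-1 *: (x + y)).
  have := @cc_convex _ _ A x y (Itv01 (andP h01).1 (andP h01).2).
  rewrite !inE => /(_ Ax Ay); congr cc_set.
  rewrite /conv/= scalerDr; congr (_ + _ *: _).
  by rewrite -[LHS]/(1 - 2^-1 : R); lra.
move=> /rA; rewrite normrZ ger0_norm ?(andP h01).1// exprMn => h.
lra.
Qed.

Lemma nearest_unique (A : closed_convex H) (a b : H) :
  is_nearest A a -> is_nearest A b -> a = b.
Proof.
move=> [Aa amin] [Ab bmin].
have ab : `|a| = `|b| by apply/eqP; rewrite eq_le amin// bmin.
have aA c : cc_set A c -> `|a| ^+ 2 <= `|c| ^+ 2.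
  by move=> Ac; rewrite lerXn2r ?nnegrE ?amin.
have := midpoint Aa Ab aA.
rewrite -ab => h; apply/eqP; rewrite -subr_eq0 -normr_eq0 -sqrf_eq0.
by rewrite eq_le sqr_ge0 andbT; lra.
Qed.

Lemma nearestP (A : closed_convex H) : is_nearest A (nearest A).
Proof.
apply: xgetPex.
pose S := [set `|a| ^+ 2 | a in cc_set A].
have S_inf : has_inf S.
  split; first by have [a Aa] := cc_nonempty A; exists (`|a| ^+ 2), a.
  by exists 0 => _ [a _ <-]; rewrite sqr_ge0.
have infS a : cc_set A a -> inf S <= `|a| ^+ 2.
  by move=> Aa; apply: ge_inf; [case: S_inf|exists a].
pose B (e : R) : set H := [set a | cc_set A a /\ `|a| ^+ 2 < inf S + e].
pose F := filter_from [set e : R | 0 < e] B.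
have FF : ProperFilter F.
  apply: filter_from_proper; last first.
    move=> e e0; have [_ [a Aa <-] ?] := inf_adherent e0 S_inf.
    by exists a.
  apply: filter_from_filter; first by exists 1 => /=.
  move=> e f /= e0 f0; exists (Num.min e f) => /=; first by rewrite lt_min e0.
  move=> a [Aa ae]; split; split=> //; apply: (lt_le_trans ae);
    by rewrite lerD2l ge_min lexx ?orbT.
have /cauchy_cvg/cvg_ex[/= l Fl] : cauchy F.
  apply/cauchy_ballP => e e0; pose d := e ^+ 2 / 4.
  have d0 : 0 < d by rewrite divr_gt0 ?exprn_gt0.
  exists (B d, B d) => /=; first by split; exists d.
  move=> [x y] /= [[Ax xd] [Ay yd]]; rewrite -ball_normE/=.
  rewrite -(@ltr_pXn2r _ 2)// ?nnegrE ?(ltW e0)//.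
  apply: (le_lt_trans (midpoint Ax Ay infS)).
  by move: xd yd; rewrite /d => ? ?; lra.
exists l; split.
  apply: (cc_closed (c := A)) => V lV.
  have [e e0 eV] := Fl _ lV.
  have [_ [a Aa <-] ?] := inf_adherent e0 S_inf.
  by exists a; split=> //; apply: eV.
move=> b Ab; rewrite -(@ler_pXn2r _ 2)// ?nnegrE//.
apply: le_trans (infS _ Ab); apply/ler_addgt0Pr => e e0.
have lF : (fun a : H => `|a| * `|a|) @ F --> `|l| * `|l|.
  by have nF := cvg_norm (Fl : (fun a : H => a) @ F --> l); exact: cvgM (nF _) (nF _).
rewrite expr2; apply: (cvgr_to_le lF); exists e => //= a [_ /ltW]; exact.
Qed.

End Nearest.

(* Main.v *)
(* The parallelogram identity at the midpoint of [b] and [p(B)] gives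
   [|b - p(B)|^2 <= 2 (|b|^2 - |p(B)|^2)] for every [b] in [B].  Hence [p(B)] is
   close to [p(A)] as soon as [B] contains a point [b] close to [p(A)] and
   [|p(B)|] is not much smaller than [|p(A)|].  Attouch-Wets convergence yields
   both, through the distances to [p(A)] and to [0].  The Fell topology yields
   the first with a set [U^-], [U] a ball around [p(A)], and the second with a
   set [(R^n \ C)^+], [C] a closed ball around [0]; this is where finite
   dimension enters, through the compactness of [C]. *)
Require Import Defs.
From mathcomp Require Import all_boot all_order all_algebra.
From mathcomp Require Import all_classical all_reals all_analysis.
From mathcomp Require Import ring lra.

Import Order.TTheory GRing.Theory Num.Theory.
Import numFieldNormedType.Exports.

Local Open Scope classical_set_scope.
Local Open Scope ring_scope.

Section NearestPoint.
Context {R : realType} {H : hilbertType R}.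
Implicit Types (x y a b : H) (A B : closed_convex H).

Lemma hilbert_parallelogram x y :
  `|x - y| ^+ 2 + `|x + y| ^+ 2 = 2 * (`|x| ^+ 2 + `|y| ^+ 2).
Proof.
have inner_sqD u v : `|u + v| ^+ 2 = `|u| ^+ 2 + 2 * inner u v + `|v| ^+ 2.
  by rewrite -!inner_norm !(innerDl, innerC _ (u + v)) (innerC v u); ring.
rewrite !inner_sqD normrN (innerC x (- y)) -scaleN1r innerZl (innerC y x).
ring.
Qed.

Lemma midpoint_closed_convex A x y :
  cc_set A x -> cc_set A y -> cc_set A (2^-1 *: (x + y)).
Proof.
move=> Ax Ay.
have h0 : 0 <= 2^-1 :> R by lra.
have h1 : 2^-1 <= 1 :> R by lra.
have := cc_convex (c := A) (x := x) (y := y) (Itv01 h0 h1).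
rewrite !inE => /(_ Ax Ay); congr cc_set.
rewrite /conv/= scalerDr; congr (_ + _ *: _).
by rewrite -[LHS]/(1 - 2^-1 : R); lra.
Qed.

(** By convexity the midpoint of [b] and [nearest B] lies in [B], so the norm of their sum is at
    least twice that of [nearest B]. *)
Lemma nearest_sqr_dist B b :
  cc_set B b -> `|b - nearest B| ^+ 2 <= 2 * (`|b| ^+ 2 - `|nearest B| ^+ 2).
Proof.
have [Bp pmin] := nearestP B; move=> Bb.
have := pmin _ (midpoint_closed_convex B b (nearest B) Bb Bp).
rewrite -(@ler_pXn2r _ 2)// ?nnegrE// normrZ exprMn ger0_norm ?invr_ge0//.
have := hilbert_parallelogram b (nearest B).
lra.
Qed.

(** Stated for an arbitrary filter so as to serve both topologies. *)
Lemma nearest_cvg (F : set_system (closed_convex H)) A : Filter F ->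
  (forall e, 0 < e -> F (hit (ball (nearest A) e))) ->
  (forall e, 0 < e -> \forall B \near F, `|nearest A| - e < `|nearest B|) ->
  nearest @ F --> nearest A.
Proof.
move=> FF Fhit Fnorm; apply/cvgrPdist_lt => e e0.
set v := `|nearest A|; have v0 : 0 <= v by exact: normr_ge0.
(* Below, [|b| - |nearest B|] is at most [2 * d] and, as [d <= 1], [|b| + |nearest B|] is at most
   [2 * (v + 1)]. Hence [|b - nearest B| ^+ 2 <= 8 * d * (v + 1) = d * k / 4 <= (e / 2) ^+ 2]. *)
pose k := 32 * (v + 1); have k0 : 0 < k by rewrite /k; lra.
pose d := Num.min 1 (Num.min (e / 2) (e ^+ 2 / k)).
have d0 : 0 < d by rewrite !lt_min ltr01 !divr_gt0 ?exprn_gt0.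
have [d1 [de dk]] : d <= 1 /\ d <= e / 2 /\ d * k <= e ^+ 2.
  by rewrite -ler_pdivlMr// !ge_min !lexx !orbT.
apply: filterS2 (Fhit d d0) (Fnorm d d0) => B [b [Bb]].
rewrite -ball_normE/= -/v => pb vd.
have bv : `|b| <= v + d.
  rewrite -(subrKC (nearest A) b) (le_trans (ler_normD _ _))// lerD2l.
  by rewrite distrC ltW.
have pB := (nearestP B).2 _ Bb.
have bpB : `|b - nearest B| <= e / 2.
  rewrite -(@ler_pXn2r _ 2)// ?nnegrE ?divr_ge0 ?(ltW e0)//.
  apply: le_trans (nearest_sqr_dist B b Bb) _.
  have pB0 : 0 <= `|nearest B| by exact: normr_ge0.
  rewrite expr_div_n; move: dk; rewrite /k => dk.
  have : 0 <= (2 * d - (`|b| - `|nearest B|)) * (`|b| + `|nearest B|).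
    by apply: mulr_ge0; lra.
  have : 0 <= d * (2 * (v + 1) - (`|b| + `|nearest B|)).
    by apply: mulr_ge0; lra.
  nra.
rewrite -(subrKA b) (le_lt_trans (ler_normD _ _))//; lra.
Qed.

Lemma dist_to_le x A a : cc_set A a -> dist_to x A <= `|x - a|.
Proof. by move=> Aa; apply: ge_inf; [exists 0 => _ [c _ <-]|exists a]. Qed.

Lemma dist_to_ge x A (r : R) :
  (forall a, cc_set A a -> r <= `|x - a|) -> r <= dist_to x A.
Proof.
have [a Aa] := cc_nonempty A => rA.
by apply: lb_le_inf => [|_ [c Ac <-]]; [exists `|x - a|, a|exact: rA].
Qed.

Lemma dist_to_mem x A : cc_set A x -> dist_to x A = 0.
Proof.
move=> Ax; apply/eqP; rewrite eq_le dist_to_ge// andbT.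
by rewrite (le_trans (dist_to_le _ _ _ Ax))// subrr normr0.
Qed.

Lemma dist_to0 A : dist_to 0 A = `|nearest A|.
Proof.
have [Ap pmin] := nearestP A; apply/eqP; rewrite eq_le.
rewrite -[X in _ <= X](normrN) -sub0r dist_to_le//=.
by apply: dist_to_ge => a Aa; rewrite sub0r normrN pmin.
Qed.

Lemma dist_to_adherent x A (e : R) :
  dist_to x A < e -> exists2 a, cc_set A a & `|x - a| < e.
Proof.
have [a Aa] := cc_nonempty A.
by move=> /inf_lt[|_ [c Ac <-] xc]; [exists `|x - a|, a|exists c].
Qed.

(** Since [e <= 1/j], the minimum can be below [e] only through [aw_gap j A B]. *)
Lemma aw_dist_lt (j : nat) A B (e : R) x : (0 < j)%N -> `|x| < j%:R ->
  e <= j%:R^-1 -> aw_dist A B < e -> `|dist_to x A - dist_to x B| < e.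
Proof.
move=> j0 xj ej ABe.
have : Num.min j%:R^-1 (aw_gap j A B) < e.
  apply: le_lt_trans ABe.
  by apply: ub_le_sup; [case: (has_sup_aw_dist A B)|exists j].
rewrite gt_min ltNge ej/=; apply: le_lt_trans.
by apply: ub_le_sup; [case: (has_sup_aw_gap A B j0)|exists x].
Qed.

(** Pointwise convergence of distance functions is all that is used of the Attouch-Wets topology. *)
Lemma near_attouch_wets (A : attouch_wets H) x (e : R) : 0 < e ->
  \forall B \near A, `|dist_to x A - dist_to x (B : closed_convex H)| < e.
Proof.
move=> e0; pose j := (Num.truncn `|x|).+1.
have d0 : 0 < Num.min e j%:R^-1 by rewrite lt_min e0 invr_gt0 ltr0n.
apply: filterS (nbhsx_ballx A _ d0) => B AB.
apply: (@lt_le_trans _ _ (Num.min e j%:R^-1)); last by rewrite ge_min lexx.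
apply: (aw_dist_lt j) => //; first exact: truncnS_gt.
by rewrite ge_min lexx orbT.
Qed.

Lemma continuous_nearest_attouch_wets :
  continuous (fun A : attouch_wets H => nearest A : H).
Proof.
move=> A; apply: (nearest_cvg _ _ (@nbhs_filter (attouch_wets H) A)) => e e0.
  apply: filterS (near_attouch_wets A (nearest A) e e0) => B.
  (* As [nearest A] has distance 0 to [A], its distance to [B] is below [e], which yields a point of
     [B] in the ball. *)
  rewrite dist_to_mem; last exact: (nearestP A).1.
  rewrite sub0r normrN => /(le_lt_trans (ler_norm _)) /dist_to_adherent.
  by move=> [b Bb pb]; exists b; split => //; rewrite -ball_normE.
apply: filterS (near_attouch_wets A 0 e e0) => B.
by rewrite !dist_to0 => /(le_lt_trans (ler_norm _)); lra.
Qed.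

Lemma open_fell_subbase (U : set (fell H)) : fell_subbase U -> open U.
Proof.
move=> sU; exists [set U]; last by rewrite bigcup_set1.
by move=> _ ->; exact: finI_from1.
Qed.

Lemma continuous_nearest_fell :
  (forall r : R, compact [set x : H | `|x| <= r]) ->
  continuous (fun A : fell H => nearest A : H).
Proof.
move=> cpt A; have [Ap pmin] := nearestP A.
apply: (nearest_cvg _ _ (@nbhs_filter (fell H) A)) => e e0.
  apply: (@open_nbhs_nbhs (fell H)); split.
    apply: open_fell_subbase; left; exists (ball (nearest A) e) => //.
    exact: ball_open.
  by exists (nearest A); split => //; exact: ballxx.
(* Missing [C] means that all norms exceed [|nearest A| - e]; for large [e] the set [C] is empty. *)
pose C := [set x : H | `|x| <= `|nearest A| - e].
have : nbhs (A : fell H) (miss C).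
  apply: (@open_nbhs_nbhs (fell H)); split.
    by apply: open_fell_subbase; right; exists C => //; exact: cpt.
  by move=> a /pmin /= pa; apply/negP; rewrite -ltNge; lra.
by apply: filterS => B /(_ _ (nearestP B).1)/negP; rewrite -ltNge.
Qed.

End NearestPoint.

Lemma continuous_euclidean (R : realType) (n : nat) :
  continuous (id : 'rV[R]_n -> euclidean R n).
Proof.
move=> l; apply/(cvgrPdist_lt (FF := @nbhs_filter 'rV[R]_n l)) => e e0.
(* Coordinates below [e / (n + 1)] give a squared norm of at most
   [n * e ^+ 2 / (n + 1) ^+ 2 < e ^+ 2], also for [n = 0]. *)
have d0 : 0 < e / n.+1%:R by rewrite divr_gt0.
apply: filterS (nbhsx_ballx l _ d0) => x [_ lx].
rewrite -(@ltr_pXn2r _ 2)// ?nnegrE ?(ltW e0)// -inner_norm.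
apply: (@le_lt_trans _ _ (\sum_(i < n) (e / n.+1%:R) ^+ 2)).
  apply: ler_sum => i _; rewrite -expr2 -real_normK ?num_real//.
  rewrite lerXn2r ?nnegrE ?(ltW d0)// !mxE.
  by have := lx ord0 i; rewrite -ball_normE => /ltW.
rewrite sumr_const card_ord -[ltLHS]mulr_natl expr_div_n mulrCA.
rewrite gtr_pMr ?exprn_gt0// ltr_pdivrMr ?exprn_gt0// mul1r -natrX ltr_nat.
by rewrite (@leq_trans n.+1)// -{1}(expn1 n.+1) leq_pexp2l.
Qed.

Lemma ler_coord_enorm (R : realType) (n : nat) (x : euclidean R n) i :
  `|x ord0 i| <= `|x|.
Proof.
rewrite -(@ler_pXn2r _ 2)// ?nnegrE// -inner_norm real_normK ?num_real//.
rewrite [leRHS](bigD1 i)//= -expr2 lerDl; apply: sumr_ge0 => j _.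
by rewrite -expr2 sqr_ge0.
Qed.

(** The ball is closed and lies in the cube of half-side [r], which is compact for the sup norm and
    stays so under the continuous identity. *)
Lemma compact_euclidean_ball (R : realType) (n : nat) (r : R) :
  compact [set x : euclidean R n | `|x| <= r].
Proof.
pose box := [set x : 'rV[R]_n | forall i, `[- r, r]%classic (x ord0 i)].
have box_compact : compact (id @` box : set (euclidean R n)).
  apply: continuous_compact.
    by apply: continuous_subspaceT; exact: continuous_euclidean.
  apply: (rV_compact (A := fun=> `[- r, r]%classic)) => _.
  exact: segment_compact.
apply: subclosed_compact box_compact _.
  apply: (preimage_closed (f := fun x : euclidean R n => `|x|)
                          (D := [set y | y <= r])).
    by move=> x _; exact: norm_continuous.
  exact: closed_le.
move=> x /= xr; exists x => // i.
by rewrite /= in_itv/= -ler_norml (le_trans (ler_coord_enorm _ _ _ _)).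
Qed.

Theorem lemma2p15 (R : realType) :
  (forall H : hilbertType R,
     continuous (fun A : attouch_wets H => `|nearest A| : R)
     /\ continuous (fun A : attouch_wets H => nearest A : H))
  /\ (forall n : nat,
     continuous (fun A : fell (euclidean R n) => nearest A : euclidean R n)).
Proof.
split=> [H|n]; last exact: continuous_nearest_fell (compact_euclidean_ball R n).
have nearestC := @continuous_nearest_attouch_wets R H.
(* Continuity of [p] gives that of its norm by composition. *)
split=> // A; apply: continuous_comp; first exact: nearestC.
exact: norm_continuous.
Qed.
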